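(* Let $a,b,c,n$ be positive integers with $c\mid n$ and $c\nmid a$. Suppose that $\{a,b,c\}$ generates $\mathbb{Z}_n$, that $c$ is indispensable, and that $a$ is dispensable (i.e., not indispensable). Let $\alpha,\beta$ be integers such that $a\equiv \alpha b+\beta c \pmod n$. Then $$\chi(C_n(a,b,c))\le\begin{cases}5 & \text{if } c=5 \text{ and } \alpha\equiv\pm 2 \pmod 5,\\ 4 & \text{if } c=13 \text{ and } \alpha\equiv \pm 5 \pmod{13},\\ 4 & \text{if } 3\nmid c \text{ and } \bigl(\alpha\equiv \pm 2 \pmod c \text{ or } 2\alpha\equiv\pm 1 \pmod c\bigr),\\ 3 & \text{otherwise,}\end{cases}$$ where the cases are read from top to bottom (the first one that applies gives the bound).
   Context: $\mathbb{Z}_n$ denotes the additive group of integers modulo $n$; the same symbol is used for an integer and its residue class modulo $n$. For integers $n,a_1,\dots,a_k$, the circulant graph $C_n(a_1,\dots,a_k)$ is the Cayley graph $\mathrm{Cay}(\mathbb{Z}_n,S)$ with $S=\{\pm a_1,\dots,\pm a_k\}$: its vertex set is $\mathbb{Z}_n$, and $x,y$ are adjacent if and only if $x-y\in S$. The chromatic number $\chi(X)$ of a graph $X$ is the smallest number of colors needed to color the vertices so that no two adjacent vertices receive the same color. For a symmetric generating set $S$ of an abelian group $G$, an element $x\in S$ is called indispensable if $S\setminus\{\pm x\}$ does not generate $G$, and dispensable otherwise. In the claim, these terms refer to $G=\mathbb{Z}_n$ and $S=\{\pm a,\pm b,\pm c\}$. *)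

(* Defs.v *)
From mathcomp Require Import all_boot all_order all_algebra all_fingroup.

Set Implicit Arguments.
Unset Strict Implicit.
Unset Printing Implicit Defensive.

Import GRing.Theory.
Local Open Scope ring_scope.

Definition colorable (T : finType) (e : rel T) (k : nat) : bool :=
  [exists f : {ffun T -> 'I_k}, [forall x, forall y, e x y ==> (f x != f y)]].

(* The search stops at #|T|, which suffices for a loopless graph; a graph with
   a loop has no proper coloring and gets the junk value #|T|.+1. *)
Definition chromatic_number (T : finType) (e : rel T) : nat :=
  find (colorable e) (iota 0 #|T|.+1).

Lemma colorable_card (T : finType) (e : rel T) :
  irreflexive e -> colorable e #|T|.
Proof.
move=> irr_e; apply/existsP; exists [ffun x => enum_rank x].
apply/forallP => x; apply/forallP => y; apply/implyP => exy; rewrite !ffunE.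
by apply: contraTneq exy => /enum_rank_inj ->; rewrite irr_e.
Qed.

Lemma colorable_irr (T : finType) (e : rel T) k :
  colorable e k -> irreflexive e.
Proof.
case/existsP => f /forallP fP x; apply/negP => exx.
by have /forallP/(_ x) := fP x; rewrite exx eqxx.
Qed.

Lemma chromatic_numberP (T : finType) (e : rel T) :
  irreflexive e ->
  colorable e (chromatic_number e) /\
  (forall k, colorable e k -> (chromatic_number e <= k)%N).
Proof.
move=> irr_e; rewrite /chromatic_number; set s := iota _ _.
have hasC : has (colorable e) s.
  apply/hasP; exists #|T|; last exact: colorable_card.
  by rewrite mem_iota /= ltnS.
have lt_find : (find (colorable e) s < #|T|.+1)%N.
  by move: hasC; rewrite has_find size_iota.
split=> [|k colk]; first by have := nth_find 0%N hasC; rewrite nth_iota.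
rewrite leqNgt; apply/negP => lt_k.
have := before_find 0%N lt_k.
by rewrite nth_iota ?(ltn_trans lt_k) // add0n colk.
Qed.

Lemma chromatic_number_le (T : finType) (e : rel T) k :
  colorable e k -> (chromatic_number e <= k)%N.
Proof.
move=> colk; have [_ +] := chromatic_numberP (colorable_irr colk).
exact.
Qed.

(* A finZmodType is also a finGroupType for its addition, so <<S>>%g is the
   additive subgroup generated by S. *)
Definition generates (G : finZmodType) (S : {set G}) : bool :=
  <<S>>%g == [set: G].

Definition indispensable (G : finZmodType) (S : {set G}) (x : G) : bool :=
  (x \in S) && ~~ generates (S :\: [set x; - x]).

Definition dispensable (G : finZmodType) (S : {set G}) (x : G) : bool :=
  (x \in S) && ~~ indispensable S x.

Definition Cay (G : finZmodType) (S : {set G}) : rel G :=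
  fun x y => x - y \in S.

(* Z/n for every n > 0, including n = 1, for which 'Z_n would be Z/2. *)
Notation Zmod n := 'I_n.-1.+1.

Definition residue (n x : nat) : Zmod n := inZp x.

Definition connection_set (n : nat) (s : seq nat) : {set Zmod n} :=
  [set x | has (fun a => (x == residue n a) || (x == - residue n a)) s].

Definition circulant (n : nat) (s : seq nat) : rel (Zmod n) :=
  Cay (connection_set n s).
Arguments circulant : clear implicits.

Definition eqmod_pm (d : nat) (x y : int) : bool :=
  (x == y %[mod d])%Z || (x == - y %[mod d])%Z.

Definition chi_bound (c : nat) (alpha : int) : nat :=
  if (c == 5%N) && eqmod_pm 5 alpha 2 then 5%N
  else if (c == 13%N) && eqmod_pm 13 alpha 5 then 4%N
  else if ~~ (3 %| c)%N && (eqmod_pm c alpha 2 || eqmod_pm c (2 * alpha) 1)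
       then 4%N
  else 3%N.

(* Main.v *)
Require Import Defs.
From mathcomp Require Import all_boot all_order all_algebra all_fingroup.
From mathcomp Require Import zify ring.

(** Put [d = gcd(a, b, n)]. Indispensability of [c] says [d > 1], and since
    [a, b, c] generate, [d] is coprime to [c] and [b] is a unit modulo [c], with
    [a] congruent to [alpha * b] there. Reduction modulo [c] kills the generator
    [c], whereas reduction modulo [d] kills [a] and [b]. So if [F] is a
    [k]-coloring of the circulant graph on [Z/c] with connections [1] and
    [alpha], and [G] a 3-coloring of the cycle on [Z/d], then the sum modulo [k]
    of [F] and [G] properly colors the whole graph, as for a Cartesian product
    of graphs ([circulant_colorable]).

    It remains to color circulants of degree four with [chi_bound c alpha]
    colors. All the colorings needed cut a circle of length [n] into [k]
    half-open arcs and give [x] the arc containing [t * x]; such a coloring is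
    proper when [t] and [t * alpha] are at circular distance at least [n / k]
    from [0] modulo [n]. This condition is [far k n], and the multiplier [t] is
    produced by [far_exists].

    For three colors, one may take [s] congruent to [alpha] or [- alpha] with
    [0 < s <= n / 2] ([half_residue]). Both [t] and [t * s] must be in the
    middle third modulo [n]. If [3 <= s <= n / 3], then as [t] runs over the
    real interval [[n / 3, 2 n / 3]], the point [t * s] crosses the whole middle
    third at least once, slowly enough for an integral [t] to be met. If
    [s > n / 3], write [n = 2 s + e]. Then [2 s] is [- e], so even multipliers
    [2 u] move in steps of [e] and the same argument works for [e >= 5]; odd
    multipliers or explicit choices settle [e = 0, 2, 3, 4]. What is left is
    [s = 2] and [e = 1], where [t = n / 3] works if 3 divides [n], and
    [(n, s) = (13, 5)]; these are the exceptional cases of the bound, in which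
    more arcs suffice. *)

Set Implicit Arguments.
Unset Strict Implicit.
Unset Printing Implicit Defensive.

Import Order.TTheory FinRing.Theory GRing.Theory Num.Theory.
Local Open Scope ring_scope.

(** * Distance to zero on a circle *)

(** For positive [n] and [k], this says that [y] is at distance at least [n / k]
    from every multiple of [n]; the quotient [q] stands for the representative
    of [y] modulo [n] that lies between [n / k] and [n - n / k]. *)
Definition far (k n y : int) : Prop :=
  exists q : int, n <= k * (y - q * n) <= (k - 1) * n.

Lemma farN (k n y : int) : far k n y -> far k n (- y).
Proof. by case=> q hq; exists (- q - 1); nia. Qed.

Lemma far_shift (k n y z w : int) : z = y + w * n -> far k n y -> far k n z.
Proof. by move=> -> [q hq]; exists (q + w); rewrite mulrDl; lia. Qed.

Lemma ceil_exists (m e : int) : 0 < m -> exists t : int, e <= m * t < e + m.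
Proof.
move=> m_gt0; exists (- ((- e) %/ m)%Z).
have := divz_eq (- e) m; have := modz_ge0 (- e) (lt0r_neq0 m_gt0).
have := ltz_pmod (- e) m_gt0; lia.
Qed.

(** * Multipliers for three colors *)

(** This colors the cycle of length [n] by three arcs. *)
Lemma far3_1 n : 2 <= n -> exists t, far 3 n t.
Proof.
move=> n_ge2; have [t ht] : exists t : int, n <= 3 * t < n + 3.
  exact: ceil_exists.
by exists t, 0; lia.
Qed.

(** With [t = n / 3] the arc coloring is reduction modulo 3, up to sign. *)
Lemma far3_third n s : (3 %| n)%Z -> ~~ (3 %| s)%Z -> 0 < n ->
  exists t, far 3 n t /\ far 3 n (t * s).
Proof.
case/dvdzP=> m -> ndvd_s n_gt0; exists m.
have [q hq] : exists q : int, 1 <= s - 3 * q <= 2 by exists (s %/ 3)%Z; lia.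
by split; [exists 0 | exists q]; nia.
Qed.

(** The real numbers [t] for which [t * s - k * n] is in the middle third form
    the interval from [(3 k + 1) n / (3 s)] to [(3 k + 2) n / (3 s)]. It has
    length at least 1 because [3 s <= n], so it contains an integer, and it lies
    in [[n / 3, 2 n / 3]] when [s <= 3 k + 1] and [3 k + 2 <= 2 s]. *)
Lemma far3_small n s : 3 <= s -> 3 * s <= n ->
  exists t, far 3 n t /\ far 3 n (t * s).
Proof.
move=> s_ge3 le_sn.
have [k hk] : exists k : int, s - 1 <= 3 * k < s - 1 + 3 by exact: ceil_exists.
have [t ht] : exists t : int,
    (3 * k + 1) * n <= 3 * s * t < (3 * k + 1) * n + 3 * s.
  by apply: ceil_exists; lia.
exists t; split; [exists 0 | exists k; lia].
have lo : s * n <= s * (3 * t) by nia.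
have hi : s * (3 * t) <= s * (2 * n) by nia.
have s_gt0 : 0 < s by lia.
by move: lo hi; rewrite !ler_pM2l //; lia.
Qed.

(** Here [t * s] is [n / 2] for every odd [t]. *)
Lemma far3_half0 n s : n = 2 * s -> 3 <= s ->
  exists t, far 3 n t /\ far 3 n (t * s).
Proof.
move=> -> s_ge3.
have [u hu] : exists u : int, 2 * s - 3 <= 6 * u < 2 * s - 3 + 6.
  exact: ceil_exists.
by exists (2 * u + 1); split; [exists 0 | exists u]; nia.
Qed.

(** Here [t * s] is [- t] for every even [t]. *)
Lemma far3_half2 n s : n = 2 * s + 2 -> 3 <= n ->
  exists t, far 3 n t /\ far 3 n (t * s).
Proof.
move=> -> n_ge3.
have [u hu] : exists u : int, 2 * s + 2 <= 6 * u < 2 * s + 2 + 6.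
  exact: ceil_exists.
by exists (2 * u); split; [exists 0 | exists (u - 1)]; nia.
Qed.

(** For odd [t] the product [t * s] is [n / 2 - 3 t / 2], so an odd [t] between
    [5 n / 9] and [2 n / 3] suffices; only [n = 13] has none. *)
Lemma far3_half3 n s : n = 2 * s + 3 -> 9 <= n -> n <> 13 ->
  exists t, far 3 n t /\ far 3 n (t * s).
Proof.
move=> def_n n_ge ne13.
have [u hu] : exists u : int, 5 * n - 9 <= 18 * u < 5 * n - 9 + 18.
  exact: ceil_exists.
have hi : 6 * u + 3 <= 2 * n by lia.
by exists (2 * u + 1); split; [exists 0 | exists (u - 1)]; nia.
Qed.

(** For odd [t] the product [t * s] is [n / 2 - 2 t], so an odd [t] between
    [5 n / 12] and [7 n / 12] suffices. *)
Lemma far3_half4 n s : n = 2 * s + 4 -> 12 <= n ->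
  exists t, far 3 n t /\ far 3 n (t * s).
Proof.
move=> def_n n_ge.
have [u hu] : exists u : int, 5 * n - 12 <= 24 * u < 5 * n - 12 + 24.
  exact: ceil_exists.
have hi : 24 * u + 12 <= 7 * n by lia.
by exists (2 * u + 1); split; [exists 0 | exists (u - 1)]; nia.
Qed.

(** The argument of [far3_small] applied to the even multipliers [t = 2 u], for
    which [t * s] is [- u * e]: the interval from [(3 k + 1) n / (3 e)] to
    [(3 k + 2) n / (3 e)] contains an integer [u], and is inside
    [[n / 6, n / 3]] when [e <= 6 k + 2] and [3 k + 2 <= e]. *)
Lemma far3_half5 n s e : n = 2 * s + e -> 5 <= e -> 3 * e <= n ->
  exists t, far 3 n t /\ far 3 n (t * s).
Proof.
move=> def_n e_ge5 le_en.
have [k hk] : exists k : int, e - 2 <= 6 * k < e - 2 + 6 by exact: ceil_exists.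
have [u hu] : exists u : int,
    (3 * k + 1) * n <= 3 * e * u < (3 * k + 1) * n + 3 * e.
  by apply: ceil_exists; lia.
have k_le : 3 * k + 2 <= e by lia.
exists (2 * u); split; last by exists (u - k - 1); nia.
have lo : e * n <= e * (6 * u) by nia.
have hi : e * (3 * u) <= e * n by nia.
have e_gt0 : 0 < e by lia.
by exists 0; move: lo hi; rewrite !ler_pM2l //; lia.
Qed.

Lemma far3_exists n s : 2 <= n -> 0 < s -> 2 * s <= n ->
  (3 %| n)%Z || (s != 2) && (n != 2 * s + 1) -> (n != 13) || (s != 5) ->
  exists t, far 3 n t /\ far 3 n (t * s).
Proof.
move=> n_ge2 s_gt0 le_sn ok not13.
have [->|s_neq1] := eqVneq s 1.
  by have [t ht] := far3_1 n_ge2; exists t; rewrite mulr1.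
have [/andP[dvd3n ndvd3s]|h3] := boolP ((3 %| n)%Z && ~~ (3 %| s)%Z).
  by apply: far3_third; lia.
have s_ge3 : 3 <= s by lia.
have [le3|lt3] := leP (3 * s) n; first exact: far3_small.
pose e := n - 2 * s.
(* The value [e = 1] is excluded: 3 would divide [n] but not [s]. *)
have [|[|[|[|]]]] : e = 0 \/ e = 2 \/ e = 3 \/ e = 4 \/ 5 <= e by lia.
- by move=> eE; apply: far3_half0; lia.
- by move=> eE; apply: far3_half2; lia.
- by move=> eE; apply: far3_half3; lia.
- by move=> eE; apply: far3_half4; lia.
- by move=> eE; apply: (@far3_half5 _ _ e); lia.
Qed.

(** * Multipliers for the chromatic bound *)

(** An integer [t] with [n / 4 <= t <= 3 n / 8] keeps both [t] and [2 t] away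
    from [0] by [n / 4]; there is none for [n = 5]. *)
Lemma far4_double n : 4 <= n -> n != 5 ->
  exists t, far 4 n t /\ far 4 n (2 * t).
Proof.
move=> n_ge4 n_neq5.
have [t ht] : exists t : int, n <= 4 * t < n + 4 by exact: ceil_exists.
by exists t; split; exists 0; lia.
Qed.

Lemma eqmod_pmP (d : nat) x y :
  reflect (exists q : int, x = y + q * d%:Z \/ x = - y + q * d%:Z)
          (eqmod_pm d x y).
Proof.
rewrite /eqmod_pm !eqz_mod_dvd.
apply: (iffP orP) => [[]/dvdzP[q hq]|[q []hq]].
- by exists q; left; lia.
- by exists q; right; lia.
- by left; apply/dvdzP; exists q; lia.
- by right; apply/dvdzP; exists q; lia.
Qed.

Lemma half_residue (n : nat) (x : int) : (0 < n)%N -> ~~ (n %| x)%Z ->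
  exists s : int, [/\ 0 < s, 2 * s <= n & eqmod_pm n x s].
Proof.
move=> n_gt0 ndvd.
have n0 : (n : int) != 0 by lia.
have lt_r := ltz_pmod x (n_gt0 : 0 < n%:Z).
have ge_r := modz_ge0 x n0.
have r0 : (x %% n)%Z != 0 by apply: contra ndvd => /eqP/dvdz_mod0P.
have := divz_eq x n.
set q := (x %/ n)%Z; set r := (x %% n)%Z in lt_r ge_r r0 * => xE.
have [h|h] := leP (2 * r) n.
  by exists r; split; [lia..|]; apply/eqmod_pmP; exists q; lia.
by exists (n%:Z - r); split; [lia..|]; apply/eqmod_pmP; exists (q + 1); lia.
Qed.

Lemma far_pm k (n : nat) t x s :
  eqmod_pm n x s -> far k n (t * s) -> far k n (t * x).
Proof.
case/eqmod_pmP=> q [] -> far_s; last move: far_s => /farN far_s.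
  by apply: (far_shift (w := t * q) _ far_s); ring.
by apply: (far_shift (w := t * q) _ far_s); ring.
Qed.

(** The circulant graph on [Z/n] with connections [1] and [x] has an arc
    coloring with [chi_bound n x] colors. *)
Lemma far_exists (n : nat) (x : int) : (1 < n)%N -> ~~ (n %| x)%Z ->
  exists t, far (chi_bound n x) n t /\ far (chi_bound n x) n (t * x).
Proof.
move=> n_gt1 ndvd; rewrite /chi_bound.
case: ifP => [/andP[/eqP n5 x2]|not5].
  subst n; exists 1; split; first by exists 0.
  by apply: (far_pm x2); exists 0.
case: ifP => [/andP[/eqP n13 x5]|not13].
  (* Modulo 13, [4 * 5] is [7], so multiplication by 4 takes both 1 and 5 into
     the range from 4 to 9. *)
  subst n; exists 4; split; first by exists 0.
  by apply: (far_pm x5); exists 1.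
case: ifP => [/andP[n3 x2]|not4].
  have n_neq2 : n <> 2%N.
    by move=> n2; subst n; case/orP: x2 => /eqmod_pmP[q hq]; lia.
  have n_neq5 : n != 5%N.
    (* Modulo 5, the inverses of [2] and [-2] are [-2] and [2]. *)
    apply: contraFN not5 => /eqP n5; subst n; rewrite /=.
    case/orP: x2 => // /eqmod_pmP[q [] hq]; apply/eqmod_pmP.
      by exists ((q + 1) %/ 2)%Z; right; lia.
    by exists ((q - 1) %/ 2)%Z; left; lia.
  have [||t [ft f2t]] := @far4_double n; [lia|lia|].
  case/orP: x2 => x2.
    by exists t; split=> //; apply: (far_pm x2); rewrite mulrC.
  exists (2 * t); split=> //; rewrite [2 * t]mulrC -mulrA.
  by apply: (far_pm x2); rewrite mulr1.
have [s [s_gt0 le_s xs]] := half_residue (ltnW n_gt1) ndvd.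
have [|||t [ft fts]] := @far3_exists n s _ s_gt0 le_s; first lia.
- have [|n3] := boolP (3 %| n)%N; first by lia.
  move/negbT: not4; rewrite n3 /= negb_or => /andP[x2 x12].
  apply/orP; right; apply/andP; split.
    by apply: contra x2 => /eqP <-.
  apply: contra x12 => /eqP nE.
  case/eqmod_pmP: xs => q hq; apply/eqmod_pmP.
  by case: hq => ->; [exists (2 * q + 1); right | exists (2 * q - 1); left]; lia.
- apply/orP; have [n13|n13] := eqVneq n 13%N; [right|by left; lia].
  by apply: contraFN not13 => /eqP s5; rewrite n13 /= -s5 -n13.
by exists t; split=> //; apply: far_pm fts.
Qed.

(** * Arc colorings *)

(** The quotient [(k * x) %/ n], taken modulo [k], is the index of the arc that
    contains [x] when the circle of length [n] is cut into [k] arcs. *)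
Lemma far_div (k n x y : int) : 0 < n -> far k n (x - y) ->
  exists q, 1 <= (k * x %/ n)%Z - (k * y %/ n)%Z - k * q <= k - 1.
Proof.
move=> n_gt0 [q hq]; exists q.
have n0 : n != 0 by lia.
have := divz_eq (k * x) n; have := modz_ge0 (k * x) n0.
have := ltz_pmod (k * x) n_gt0.
have := divz_eq (k * y) n; have := modz_ge0 (k * y) n0.
have := ltz_pmod (k * y) n_gt0.
set Y := (_ %/ _)%Z; set X := (_ %/ _)%Z => h1 h2 h3 h4 h5 h6.
have lo : n * 0 < n * (X - Y - k * q) by lia.
have hi : n * (X - Y - k * q) < n * k by lia.
by move: lo hi; rewrite !ltr_pM2l //; lia.
Qed.

Lemma div_period (k n x y w : int) : 0 < n -> x = y + w * n ->
  (k * x %/ n)%Z = (k * y %/ n)%Z + k * w.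
Proof.
move=> n_gt0 ->; rewrite mulrDr mulrA divzDr ?dvdz_mull // mulzK //; lia.
Qed.

Lemma colorable_int (T : finType) (e : rel T) (k : nat) (f : T -> int) :
  (0 < k)%N -> (forall x y, e x y -> ~~ (k %| f x - f y)%Z) -> colorable e k.
Proof.
case: k => // k _ fP.
have ge0 z : 0 <= (f z %% k.+1)%Z by apply: modz_ge0.
have lt z : (f z %% k.+1)%Z < k.+1 by apply: ltz_pmod.
apply/existsP; exists [ffun x => inord `|(f x %% k.+1)%Z|%N].
apply/forallP=> x; apply/forallP=> y; apply/implyP => /fP; rewrite !ffunE.
apply: contra => /eqP/(congr1 val) /=.
have lt_abs z : (`|(f z %% k.+1)%Z| < k.+1)%N.
  by have := ge0 z; have := lt z; lia.
rewrite !inordK // => h; rewrite -eqz_mod_dvd; apply/eqP.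
by have := ge0 x; have := ge0 y; lia.
Qed.

(** * Residues modulo n *)

Lemma residueD n x y : residue n (x + y) = residue n x + residue n y.
Proof. by apply: val_inj; rewrite /= modnDm. Qed.

Lemma residueM n x m : residue n (x * m) = residue n x *+ m.
Proof.
elim: m => [|m IHm]; last by rewrite mulnS residueD IHm mulrS.
by rewrite muln0; apply: val_inj; rewrite /= mod0n.
Qed.

Lemma natmul_residue n (x : Zmod n) : x = residue n 1 *+ x.
Proof. by rewrite -residueM mul1n; apply: val_inj; rewrite /= modn_small. Qed.

Lemma dvd_residue n p x : (0 < n)%N -> (p %| n)%N ->
  (p %| residue n x)%N = (p %| x)%N.
Proof. by move=> n_gt0 dvd_pn; rewrite /= prednK // /dvdn modn_dvdm. Qed.

Lemma dvd_oppr n p (x : Zmod n) : (0 < n)%N -> (p %| n)%N ->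
  (p %| x)%N -> (p %| - x)%N.
Proof.
case: n x => // n x _ dvd_pn dvd_px; rewrite /= /dvdn modn_dvdm //.
by rewrite -/(dvdn _ _) dvdn_sub.
Qed.

Lemma residue_diff n (x y : Zmod n) a : (0 < n)%N -> x - y = residue n a ->
  exists w : int,
    (nat_of_ord x)%:Z = (nat_of_ord y)%:Z + a%:Z + w * n%:Z.
Proof.
case: n x y => // n x y _ /eqP; rewrite subr_eq => /eqP xE.
exists (- ((y + a) %/ n.+1)%N%:Z).
have -> : nat_of_ord x = ((y + a) %% n.+1)%N by rewrite xE /= modnDml addnC.
have := divn_eq (y + a) n.+1; lia.
Qed.

Lemma generates_dvd n p (S : {set Zmod n}) : (0 < n)%N -> (p %| n)%N ->
  (forall x, x \in S -> (p %| x)%N) -> generates S -> p = 1%N.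
Proof.
case: n S => // n S _ dvd_pn dvdS /eqP genS.
have grP : group_set [set x : Zmod n.+1 | (p %| x)%N].
  apply/group_setP; split=> [|x y]; first by rewrite inE dvdn0.
  rewrite !inE => px py; rewrite zmodMgE /= /dvdn modn_dvdm //.
  by rewrite -/(dvdn _ _) dvdn_add.
have /subsetP/(_ (residue n.+1 1)) : <<S>>%g \subset group grP.
  by rewrite gen_subG; apply/subsetP => x /dvdS; rewrite inE.
by rewrite genS !inE dvd_residue // dvdn1 => /(_ isT)/eqP.
Qed.

Lemma residue_gcd n (H : {group Zmod n}) x y :
  residue n x \in H -> residue n y \in H -> residue n (gcdn x y) \in H.
Proof.
have [->|x_gt0] := posnP x; first by rewrite gcd0n.
move=> Hx Hy; have [u v uvE _] := egcdnP y x_gt0.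
have <- : residue n x *+ u - residue n y *+ v = residue n (gcdn x y).
  rewrite -!residueM [(x * u)%N]mulnC uvE residueD mulnC addrAC subrr.
  by rewrite add0r.
by rewrite -zmodVgE -zmodMgE -!zmodXgE groupM ?groupV ?groupX.
Qed.

Lemma coprime_generates n a b (S : {set Zmod n}) :
  (0 < n)%N -> gcdn (gcdn a b) n = 1%N ->
  residue n a \in S -> residue n b \in S -> generates S.
Proof.
case: n S => // n S _ gcd1 Sa Sb; rewrite /generates eqEsubset subsetT /=.
have H1 : residue n.+1 1 \in <<S>>%g.
  rewrite -gcd1; apply: residue_gcd.
    by apply: residue_gcd; apply: mem_gen.
  suff -> : residue n.+1 n.+1 = 1%g by exact: group1.
  by apply: val_inj; rewrite /= modnn.
apply/subsetP=> x _; rewrite [x](@natmul_residue n.+1) -zmodXgE.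
exact: groupX.
Qed.

Lemma inverse_mod (b c : nat) : (0 < b)%N -> coprime b c ->
  exists v w : int, v * b%:Z = 1 + w * c%:Z.
Proof.
move=> b_gt0 /eqP bc; have [u v uvE _] := egcdnP c b_gt0.
by exists u, v; rewrite bc in uvE; lia.
Qed.

(** * Coloring a circulant graph through two quotients *)

(** The color of [x] is the sum modulo [k] of an arc color in [Z/c], which
    ignores the generator [c], and a color in [{0, 1, 2}] coming from [Z/d],
    which ignores [a] and [b]. The latter is reduced modulo 3 before the
    addition, so that distinct values stay distinct modulo [k]. *)
Lemma circulant_colorable (n a b c d k : nat) (t u : int) :
  (0 < n)%N -> (2 < k)%N -> (c %| n)%N -> (d %| n)%N ->
  (d %| a)%N -> (d %| b)%N ->
  far k c (t * a) -> far k c (t * b) -> far 3 d (u * c) ->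
  colorable (circulant n [:: a; b; c]) k.
Proof.
move=> n_gt0 k_gt2 dvd_cn dvd_dn dvd_da dvd_db far_a far_b far_c.
have c_gt0 : 0 < c%:Z by have := dvdn_gt0 n_gt0 dvd_cn.
have d_gt0 : 0 < d%:Z by have := dvdn_gt0 n_gt0 dvd_dn.
pose F (x : int) : int := (k%:Z * (t * x) %/ c)%Z.
pose G (x : int) : int := (3 * (u * x) %/ d)%Z.
pose f (x : Zmod n) : int := F (nat_of_ord x) + (G (nat_of_ord x) %% 3)%Z.
have [nc ncE] : exists nc : int, n%:Z = nc * c%:Z by exact: (@dvdzP c n).
have [nd ndE] : exists nd : int, n%:Z = nd * d%:Z by exact: (@dvdzP d n).
have step s (x y : Zmod n) : s \in [:: a; b; c] -> x - y = residue n s ->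
  ~~ (k %| f x - f y)%Z.
  move=> s_in /(residue_diff n_gt0)[w xE]; rewrite /f.
  set X : int := nat_of_ord x; set Y : int := nat_of_ord y.
  rewrite -/X -/Y in xE.
  have in_ab : (d %| s)%N -> far k c (t * s) -> ~~ (k %| f x - f y)%Z.
    move=> dvd_ds far_s; have [m sE] : exists m : int, s%:Z = m * d%:Z.
      exact: (@dvdzP d s).
    have GE : G X = G Y + 3 * (u * (m + w * nd)).
      by apply: div_period => //; rewrite xE sE ndE; ring.
    have -> : f x - f y = F X - F Y.
      by rewrite /f -/X -/Y GE [G Y + _]addrC [3 * _]mulrC modzMDl; ring.
    have [|q hq] := @far_div k%:Z c%:Z (t * X) (t * Y) c_gt0.
      by apply: (far_shift (w := t * w * nc) _ far_s); rewrite xE ncE; ring.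
    apply/negP => /dvdzP[m' hm']; move: hq; rewrite -/(F X) -/(F Y) hm'.
    by clear; have [|] := leP (m' - q) 0; nia.
  have in_c : s = c -> ~~ (k %| f x - f y)%Z.
    move=> sE.
    have FE : F X = F Y + k%:Z * (t * (1 + w * nc)).
      by apply: div_period => //; rewrite xE sE ncE; ring.
    have [|q hq] := @far_div 3 d%:Z (u * X) (u * Y) d_gt0.
      by apply: (far_shift (w := u * w * nd) _ far_c); rewrite xE ndE sE; ring.
    rewrite /f -/X -/Y FE; apply/negP => /dvdzP[m' hm'].
    have {hm'} : (G X %% 3)%Z - (G Y %% 3)%Z = (m' - t * (1 + w * nc)) * k.
      by rewrite mulrBl -hm'; ring.
    move: hq k_gt2; rewrite -/(G X) -/(G Y).
    move: (G X) (G Y) (m' - _) => gx gy z; clear => hq k_gt2 hz.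
    have : (gx %% 3)%Z <> (gy %% 3)%Z by lia.
    have : -3 < (gx %% 3)%Z - (gy %% 3)%Z < 3 by lia.
    have [z0|[]] : z = 0 \/ 1 <= z \/ z <= -1 by lia.
    - by rewrite z0 in hz; lia.
    - by move: hz; nia.
    - by move: hz; nia.
  move: s_in; rewrite !inE => /or3P[]/eqP sE.
  - by apply: in_ab; rewrite sE.
  - by apply: in_ab; rewrite sE.
  - exact: in_c.
apply: (@colorable_int _ _ _ f); first lia.
move=> x y; rewrite /circulant /Cay inE => /hasP[s s_in /orP[]/eqP xy].
  exact: step s_in xy.
rewrite -opprB dvdzE abszN -dvdzE; apply: (step s) => //.
by rewrite -opprB xy opprK.
Qed.

Theorem theorem1p1 (a b c n : nat) (alpha beta : int)
  (ha : (0 < a)%N) (hb : (0 < b)%N) (hc : (0 < c)%N) (hn : (0 < n)%N)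
  (hcn : (c %| n)%N) (hca : ~~ (c %| a)%N)
  (hgen : generates [set residue n a; residue n b; residue n c])
  (hcind : indispensable (connection_set n [:: a; b; c]) (residue n c))
  (hadis : dispensable (connection_set n [:: a; b; c]) (residue n a))
  (hab : (a%:Z = alpha * b%:Z + beta * c%:Z %[mod n%:Z])%Z) :
  (chromatic_number (circulant n [:: a; b; c]) <= chi_bound c alpha)%N.
Proof.
apply: chromatic_number_le.
have [m nE] := dvdnP hcn.
have {hab} [w aE] : exists w : int, a%:Z = alpha * b%:Z + w * c%:Z.
  move/eqP: hab; rewrite eqz_mod_dvd => /dvdzP[w hw].
  by exists (beta + w * m%:Z); rewrite nE in hw; lia.
have common p : (p %| n)%N -> (p %| a)%N -> (p %| b)%N -> (p %| c)%N -> p = 1%N.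
  move=> pn pa pb pc; apply: generates_dvd hgen => // x.
  by rewrite !inE => /orP[/orP[]|] /eqP->; rewrite dvd_residue.
have co_bc : coprime b c.
  apply/eqP/common; rewrite ?dvdn_gcdl ?dvdn_gcdr //.
    exact: dvdn_trans (dvdn_gcdr _ _) hcn.
  have pb := dvdn_gcdl b c; have pc := dvdn_gcdr b c.
  suff: (gcdn b c %| a%:Z)%Z by [].
  by rewrite aE; apply: rpredD; apply: dvdz_mull.
pose d := gcdn (gcdn a b) n.
have dn : (d %| n)%N by exact: dvdn_gcdr.
have da : (d %| a)%N := dvdn_trans (dvdn_gcdl _ _) (dvdn_gcdl _ _).
have db : (d %| b)%N := dvdn_trans (dvdn_gcdl _ _) (dvdn_gcdr _ _).
have co_cd : coprime c d.
  by apply/eqP/common; rewrite ?dvdn_gcdl //; apply: dvdn_trans (dvdn_gcdr _ _) _.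
(* Since [c] divides neither [a] nor [b], removing [c] and [- c] from the
   connection set keeps [a] and [b]. *)
have in_S x : x \in [:: a; b; c] -> ~~ (c %| x)%N -> residue n x \in
    connection_set n [:: a; b; c] :\: [set residue n c; - residue n c].
  move=> x_in ncx; rewrite in_setD; apply/andP; split; last first.
    by rewrite inE; apply/hasP; exists x => //; rewrite eqxx.
  apply: contra ncx; rewrite !inE -(dvd_residue x hn hcn).
  by case/orP=> /eqP->; [|apply: dvd_oppr => //]; rewrite dvd_residue.
have ndvd_alpha : ~~ (c %| alpha)%Z.
  apply: contra hca => c_alpha; suff: (c %| a%:Z)%Z by [].
  by rewrite aE; apply: rpredD; [apply: dvdz_mulr|apply: dvdz_mull].
have c_gt1 : (1 < c)%N.
  by move: hca; case: (c) hc => [|[|]] //; rewrite dvd1n.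
have d_gt1 : (1 < d)%N.
  rewrite ltn_neqAle (dvdn_gt0 hn dn) andbT eq_sym.
  apply: contraL hcind => /eqP d1; rewrite /indispensable negb_and negbK orbC.
  rewrite (@coprime_generates n a b) //; apply: in_S => //.
  - by rewrite inE eqxx.
  - by rewrite !inE eqxx orbT.
  by apply: contraTN co_bc => cb; rewrite /coprime gcdnC (gcdn_idPl cb); lia.
have [t [ft fta]] := far_exists c_gt1 ndvd_alpha.
have [u fu] := @far3_1 d d_gt1.
have [b' [bw b'E]] := inverse_mod hb co_bc.
have [c' [cw c'E]] := inverse_mod hc co_cd.
have k_gt2 : (2 < chi_bound c alpha)%N.
  by rewrite /chi_bound; do ![case: ifP => _].
(* Multiplying by the inverse of [b] modulo [c] turns [b, a] into [1, alpha],
   and by that of [c] modulo [d] turns [c] into [1]. *)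
apply: (@circulant_colorable n a b c d _ (t * b') (u * c')) => //.
- apply: (far_shift (w := t * alpha * bw + t * b' * w) _ fta); rewrite aE.
  have -> : t * b' * (alpha * b + w * c) =
            t * alpha * (b' * b) + t * b' * w * c by ring.
  by rewrite b'E; ring.
- by rewrite -mulrA b'E; apply: (far_shift (w := t * bw) _ ft); ring.
- by rewrite -mulrA c'E; apply: (far_shift (w := u * cw) _ fu); ring.
Qed.
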